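(* Let $E:\mathbb R^d\to\mathbb R$ be twice continuously differentiable, $F=-\nabla E$, $J=-\nabla^2E$, and suppose Assumption A (stated in the context) holds. Fix $T>0$, $k\ge1$, an initial state $x_0\in S^{d-1}$ (the unit sphere of $\mathbb R^d$) and orthonormal vectors $v_{1,0},\dots,v_{k,0}\in\mathbb R^d$ with $v_{i,0}^\top x_0=0$ for $1\le i\le k$. Let $(x(t),v_1(t),\dots,v_k(t))$, $t\in[0,T]$, be the solution of the constrained high-index saddle dynamics $$\frac{dx}{dt}=\Big(I-2\sum_{j=1}^k v_jv_j^\top\Big)F(x)-xx^\top F(x),$$ $$\frac{dv_i}{dt}=\Big(I-v_iv_i^\top-2\sum_{j=1}^{i-1}v_jv_j^\top\Big)J(x)v_i-xx^\top J(x)v_i+x\,v_i^\top F(x),\quad 1\le i\le k,$$ with $x(0)=x_0$, $v_i(0)=v_{i,0}$. For $N\in\mathbb N$ let $\tau=T/N$, $t_n=n\tau$, and let $x_n$, $v_{i,n}$ be generated by the discrete constrained HiSD scheme given in the context. Then for $\tau$ sufficiently small, $$\|x_n-x(t_n)\|+\sum_{i=1}^k\|v_{i,n}-v_i(t_n)\|\le Q\tau,\qquad 1\le n\le N,$$ where the constant $Q>0$ is independent of $\tau$, $n$ and $N$.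
   Context: $\|\cdot\|$ is the Euclidean ($l^2$) norm of a vector, or the induced norm of a matrix; $I$ is the $d\times d$ identity. Assumption A: there is a constant $L>0$ such that for all $x,x_1,x_2\in\mathbb R^d$, $\|J(x_2)-J(x_1)\|+\|F(x_2)-F(x_1)\|\le L\|x_2-x_1\|$ and $\|F(x)\|\le L(1+\|x\|)$. Discrete constrained HiSD scheme (relaxation parameters equal to $1$): for $n=1,\dots,N$, $$\tilde x_n=x_{n-1}+\tau\Big(I-2\sum_{j=1}^k v_{j,n-1}v_{j,n-1}^\top\Big)F(x_{n-1}),\qquad x_n=\frac{\tilde x_n}{\|\tilde x_n\|},$$ $$\tilde v_{i,n}=v_{i,n-1}+\tau J(x_{n-1})v_{i,n-1},\qquad \hat v_{i,n}=\tilde v_{i,n}-(\tilde v_{i,n}^\top x_n)\,x_n,\quad 1\le i\le k,$$ and then, successively for $i=1,\dots,k$ (Gram–Schmidt orthonormalization), $$v_{i,n}=\frac1{Z_{i,n}}\Big(\hat v_{i,n}-\sum_{j=1}^{i-1}(\hat v_{i,n}^\top v_{j,n})v_{j,n}\Big),\qquad Z_{i,n}=\Big\|\hat v_{i,n}-\sum_{j=1}^{i-1}(\hat v_{i,n}^\top v_{j,n})v_{j,n}\Big\|$$ (for $\tau$ sufficiently small $\|\tilde x_n\|\ne0$ and $Z_{i,n}\neq0$). ''$\tau$ sufficiently small'' means $\tau\le\tau_0$ for some $\tau_0>0$ independent of $n$ and $N$. Constants may depend on $E$, $L$, $d$, $k$, $T$ and the initial data. *)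

(* Defs.v *)
From HB Require Import structures.
From mathcomp Require Import all_boot all_order all_algebra.
From mathcomp Require Import all_classical all_reals all_analysis.
Set Implicit Arguments.
Unset Strict Implicit.
Unset Printing Implicit Defensive.
Import Order.TTheory GRing.Theory Num.Theory.
Import numFieldNormedType.Exports.
Local Open Scope classical_set_scope.
Local Open Scope ring_scope.

Section Euclidean.
Context {R : realType} {d : nat}.
Implicit Types (u v : 'cV[R]_d) (A : 'M[R]_d).

Definition dot u v : R := \sum_i u i 0 * v i 0.

(* The library norm `|u| on matrices is the max norm; it induces the same
   topology, but the quantitative estimates use the Euclidean norm. *)
Definition enorm u : R := Num.sqrt (dot u u).

Definition opnorm A : R := sup [set enorm (A *m u) | u in [set u | enorm u = 1]].

Definition orthonormal_family k (v : 'I_k -> 'cV[R]_d) : Prop :=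
  forall i j, dot (v i) (v j) = (i == j)%:R.

End Euclidean.

Section Energy.
Context {R : realType} {d : nat}.
Implicit Types E : 'cV[R]_d -> R.

Definition gradient E (x : 'cV[R]_d) : 'cV[R]_d :=
  \col_i 'D_(delta_mx i 0) E x.

Definition hessian E (x : 'cV[R]_d) : 'M[R]_d :=
  \matrix_(i, j) 'D_(delta_mx j 0) (fun y => 'D_(delta_mx i 0) E y) x.

(* Differentiability is required explicitly because 'D_v has a junk value where
   the directional derivative does not exist. *)
Definition twice_continuously_differentiable E : Prop :=
  [/\ forall x, differentiable E x,
      forall x, differentiable (gradient E) x
    & continuous (hessian E)].

Definition force E (x : 'cV[R]_d) : 'cV[R]_d := - gradient E x.

Definition force_jac E (x : 'cV[R]_d) : 'M[R]_d := - hessian E x.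

Definition assumptionA (L : R) (F : 'cV[R]_d -> 'cV[R]_d)
    (J : 'cV[R]_d -> 'M[R]_d) : Prop :=
  (forall x1 x2,
     opnorm (J x2 - J x1) + enorm (F x2 - F x1) <= L * enorm (x2 - x1)) /\
  (forall x, enorm (F x) <= L * (1 + enorm x)).

End Energy.

Section Dynamics.
Context {R : realType} {d k : nat}.
Variables (F : 'cV[R]_d -> 'cV[R]_d) (J : 'cV[R]_d -> 'M[R]_d).
Implicit Types (x : 'cV[R]_d) (v : 'I_k -> 'cV[R]_d).

Definition chisd_rhs_x x v : 'cV[R]_d :=
  (1%:M - 2 *: \sum_j v j *m (v j)^T) *m F x - x *m x^T *m F x.

Definition chisd_rhs_v x v (i : 'I_k) : 'cV[R]_d :=
  (1%:M - v i *m (v i)^T - 2 *: \sum_(j < k | (j < i)%N) v j *m (v j)^T)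
    *m J x *m v i
  - x *m x^T *m J x *m v i + dot (v i) (F x) *: x.

(* Derivatives at interior times together with continuity on [0, T]; since the
   right-hand sides are continuous this yields the one-sided derivatives at
   0 and T. *)
Definition chisd_solution (T : R) (x0 : 'cV[R]_d) (v0 : 'I_k -> 'cV[R]_d)
    (x : R -> 'cV[R]_d) (v : 'I_k -> R -> 'cV[R]_d) : Prop :=
  [/\ x 0 = x0 /\ (forall i, v i 0 = v0 i),
      {within `[0, T], continuous x},
      forall i, {within `[0, T], continuous (v i)},
      forall t, 0 < t < T ->
        is_derive t 1 x (chisd_rhs_x (x t) (v^~ t))
    & forall t i, 0 < t < T ->
        is_derive t 1 (v i) (chisd_rhs_v (x t) (v^~ t) i)].

Definition pre_x (tau : R) x v : 'cV[R]_d :=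
  x + tau *: ((1%:M - 2 *: \sum_j v j *m (v j)^T) *m F x).

Definition pre_v (tau : R) x v (i : 'I_k) : 'cV[R]_d :=
  v i + tau *: (J x *m v i).

Definition proj_v (tau : R) x v (x' : 'cV[R]_d) (i : 'I_k) : 'cV[R]_d :=
  pre_v tau x v i - dot (pre_v tau x v i) x' *: x'.

(* [v'] is the family of vectors produced so far; only its members of index
   j < i are used. *)
Definition gram_schmidt_residual (w v' : 'I_k -> 'cV[R]_d) (i : 'I_k) :
    'cV[R]_d :=
  w i - \sum_(j < k | (j < i)%N) dot (w i) (v' j) *: v' j.

(* The inverse is total with 0^-1 = 0, so a degenerate normalization yields the
   zero vector; this is at distance 1 from every unit vector. *)
Definition normalize (u : 'cV[R]_d) : 'cV[R]_d := (enorm u)^-1 *: u.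

Definition chisd_step (tau : R) x v (x' : 'cV[R]_d) (v' : 'I_k -> 'cV[R]_d) :
    Prop :=
  x' = normalize (pre_x tau x v) /\
  forall i, v' i =
    normalize (gram_schmidt_residual (proj_v tau x v x') v' i).

Definition chisd_scheme (tau : R) (N : nat)
    (x0 : 'cV[R]_d) (v0 : 'I_k -> 'cV[R]_d)
    (xn : nat -> 'cV[R]_d) (vn : 'I_k -> nat -> 'cV[R]_d) : Prop :=
  [/\ xn 0%N = x0, forall i, vn i 0%N = v0 i
    & forall n, (n < N)%N ->
        chisd_step tau (xn n) (vn^~ n) (xn n.+1) (vn^~ n.+1)].

End Dynamics.

(* Main.v *)
Require Import Defs.
From HB Require Import structures.
From mathcomp Require Import all_boot all_order all_algebra.
From mathcomp Require Import all_classical all_reals all_analysis.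
From mathcomp Require Import ring lra.
Set Implicit Arguments.
Unset Strict Implicit.
Unset Printing Implicit Defensive.
Import Order.TTheory GRing.Theory Num.Theory.
Import numFieldNormedType.Exports.
Local Open Scope classical_set_scope.
Local Open Scope ring_scope.

(** A one-step method converges with order one when its increment agrees with
    that of the flow up to O(tau^2) and the vector field is Lipschitz where both
    trajectories live.

    Consistency. One step of the scheme is an explicit Euler step followed by
    normalizations, a projection and a Gram-Schmidt process. Its increment is
    computed by a calculus of first-order jets: a quantity f attached to a step
    has the jet (f0, f1) when f = f0 + tau f1 + O(tau^2), uniformly over the
    steps that start on the constraint manifold, where x is a unit vector and
    the v_i are orthonormal and orthogonal to x. Jets are compatible with sums
    and bounded bilinear maps ([jet_bilinear]); normalizing a vector with unit
    leading term removes from f1 its component along f0 ([jet_normalize]).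
    Carried through a step, with strong induction on i for the Gram-Schmidt
    process, the calculus yields the right-hand sides of the dynamics as the
    first-order coefficients ([jet_new_x], [jet_new_v]). The factor 2 in the
    equation of v_i arises from v_j . J v_i + v_i . J v_j, that is, from the
    symmetry of the Hessian ([hessian_sym]). For small tau no normalization
    degenerates, so the new state lies again on the manifold
    ([manifold_preserved]) and the expansion applies at every step.

    Stability. The discrete states have norm at most 1, and the vector field is
    bounded and Lipschitz on the box of radius 2, because F and J are Lipschitz
    and the rest is polynomial. The bound on the continuous trajectory comes out
    of the error estimate: at time n tau the estimate puts the trajectory within
    1/2 of the discrete state, and a first-exit argument keeps it in the box of
    radius 2 during the next step ([ode_stays_in_box]). The discrete Gronwall
    recursion then runs over the whole of [0, T] ([one_step_convergence]). *)

(** * Bounded bilinear maps *)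

Section BoundedBilinear.
Context {R : realType}.

Lemma le_normD {V : normedModType R} (u v : V) (a b : R) :
  `|u| <= a -> `|v| <= b -> `|u + v| <= a + b.
Proof. by move=> ua vb; rewrite (le_trans (ler_normD _ _))// lerD. Qed.

(** Dot product, scaling and matrix-vector product are all instances, so one
    product rule serves the three of them, for jets as well as for Lipschitz
    estimates. *)
Definition bounded_bilinear {U V W : normedModType R} (B : U -> V -> W) :=
  [/\ forall v, linear (B^~ v), forall u, linear (B u)
    & exists K, forall u v, `|B u v| <= K * `|u| * `|v|].

Lemma bilinear_boundP {U V W : normedModType R} {B : U -> V -> W} :
  bounded_bilinear B ->
  exists2 K, 0 <= K & forall a b u v, `|u| <= a -> `|v| <= b ->
    `|B u v| <= K * (a * b).
Proof.
move=> [_ _ [K BK]]; exists `|K| => // a b u v ua vb.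
apply: (le_trans (BK u v)); rewrite -mulrA.
rewrite (le_trans (ler_wpM2r _ (ler_norm K))) ?mulr_ge0//.
by rewrite ler_wpM2l// ler_pM.
Qed.

Lemma bilinearBl {U V W : normedModType R} {B : U -> V -> W} :
  bounded_bilinear B -> forall u u' v, B (u - u') v = B u v - B u' v.
Proof.
by move=> [Bl _ _] u u' v; rewrite addrC -scaleN1r (Bl v) scaleN1r addrC.
Qed.

Lemma bilinearBr {U V W : normedModType R} {B : U -> V -> W} :
  bounded_bilinear B -> forall u v v', B u (v - v') = B u v - B u v'.
Proof.
by move=> [_ Br _] u v v'; rewrite addrC -scaleN1r (Br u) scaleN1r addrC.
Qed.

Lemma bilinearPl {U V W : normedModType R} {B : U -> V -> W} :
  bounded_bilinear B -> forall u u' v a, B (u + a *: u') v = B u v + a *: B u' v.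
Proof. by move=> [Bl _ _] u u' v a; rewrite addrC (Bl v) addrC. Qed.

Lemma bilinearPr {U V W : normedModType R} {B : U -> V -> W} :
  bounded_bilinear B -> forall u v v' a, B u (v + a *: v') = B u v + a *: B u v'.
Proof. by move=> [_ Br _] u v v' a; rewrite addrC (Br u) addrC. Qed.

Lemma scale_bounded_bilinear (V : normedModType R) :
  bounded_bilinear (fun (a : R) (v : V) => a *: v).
Proof.
split=> [v a b c|a b u v|].
- by rewrite scalerDl scalerA.
- by rewrite scalerDr !scalerA mulrC.
- by exists 1 => a v; rewrite mul1r normrZ.
Qed.

Lemma sum_le_card {I : finType} (f : I -> R) a :
  (forall i, f i <= a) -> \sum_i f i <= #|I|%:R * a.
Proof.
by move=> fa; rewrite mulr_natl -sumr_const; apply: ler_sum => i _; exact: fa.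
Qed.

Lemma norm_coord_le {m n} (A : 'M[R]_(m, n)) i j : `|A i j| <= `|A|.
Proof.
rewrite [leRHS]/Num.Def.normr/= mx_normrE.
exact: (le_bigmax _ (fun ij : 'I_m * 'I_n => `|A ij.1 ij.2|) (i, j)).
Qed.

Lemma norm_mx_le {m n} (A : 'M[R]_(m, n)) (a : R) :
  0 <= a -> (forall i j, `|A i j| <= a) -> `|A| <= a.
Proof.
move=> a0 Aa; rewrite [leLHS]/Num.Def.normr/= mx_normrE.
by apply: bigmax_le => // i _; exact: Aa.
Qed.

Lemma mulmx_bounded_bilinear m n p :
  bounded_bilinear (fun (A : 'M[R]_(m, n)) (B : 'M[R]_(n, p)) => A *m B).
Proof.
split=> [B a A A'|A a B B'|].
- by rewrite mulmxDl scalemxAl.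
- by rewrite mulmxDr scalemxAr.
exists n%:R => A B; apply: norm_mx_le => [|i j]; first by rewrite !mulr_ge0.
rewrite mxE (le_trans (ler_norm_sum _ _ _))//.
rewrite -mulrA -[X in X%:R]card_ord sum_le_card// => l.
by rewrite normrM ler_pM ?norm_coord_le.
Qed.

End BoundedBilinear.

(** * Euclidean geometry of column vectors *)

Section Euclid.
Context {R : realType} {d : nat}.
Implicit Types u v w : 'cV[R]_d.

Lemma dotE u v : dot u v = (u^T *m v) 0 0.
Proof. by rewrite mxE; apply: eq_bigr => i _; rewrite mxE. Qed.

Lemma dotC u v : dot u v = dot v u.
Proof. by apply: eq_bigr => i _; rewrite mulrC. Qed.

Lemma dotDl u v w : dot (u + v) w = dot u w + dot v w.
Proof. by rewrite !dotE linearD mulmxDl mxE. Qed.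

Lemma dotZl a u v : dot (a *: u) v = a * dot u v.
Proof. by rewrite !dotE linearZ -scalemxAl mxE. Qed.

Lemma dotDr u v w : dot u (v + w) = dot u v + dot u w.
Proof. by rewrite dotC dotDl !(dotC u). Qed.

Lemma dotZr a u v : dot u (a *: v) = a * dot u v.
Proof. by rewrite dotC dotZl dotC. Qed.

Lemma dotNl u v : dot (- u) v = - dot u v.
Proof. by rewrite -scaleN1r dotZl mulN1r. Qed.

Lemma dotNr u v : dot u (- v) = - dot u v.
Proof. by rewrite dotC dotNl dotC. Qed.

Lemma dotBl u v w : dot (u - v) w = dot u w - dot v w.
Proof. by rewrite dotDl dotNl. Qed.

Lemma dotBr u v w : dot u (v - w) = dot u v - dot u w.
Proof. by rewrite dotDr dotNr. Qed.

Lemma dot0l u : dot 0 u = 0.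
Proof. by rewrite -[0](scale0r u) dotZl mul0r. Qed.

Lemma dot0r u : dot u 0 = 0.
Proof. by rewrite dotC dot0l. Qed.

Lemma dot_suml (I : Type) (r : seq I) (P : pred I) (f : I -> 'cV[R]_d) u :
  dot (\sum_(i <- r | P i) f i) u = \sum_(i <- r | P i) dot (f i) u.
Proof. exact: (big_morph _ (fun v w => dotDl v w u) (dot0l u)). Qed.

Lemma dot_sumr (I : Type) (r : seq I) (P : pred I) (f : I -> 'cV[R]_d) u :
  dot u (\sum_(i <- r | P i) f i) = \sum_(i <- r | P i) dot u (f i).
Proof. exact: (big_morph _ (dotDr u) (dot0r u)). Qed.

Lemma dot_sym_mx (A : 'M[R]_d) u v : A^T = A -> dot (A *m u) v = dot (A *m v) u.
Proof.
by move=> AT; rewrite [RHS]dotC !dotE trmx_mul AT mulmxA.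
Qed.

Lemma outer_mulmx u v w : u *m v^T *m w = dot v w *: u.
Proof. by rewrite -mulmxA [v^T *m w]mx11_scalar -dotE mul_mx_scalar. Qed.

Lemma dot_ge0 u : 0 <= dot u u.
Proof. by apply: sumr_ge0 => i _; rewrite -expr2 sqr_ge0. Qed.

Lemma enorm_ge0 u : 0 <= enorm u. Proof. exact: sqrtr_ge0. Qed.

Lemma enorm_sqr u : enorm u ^+ 2 = dot u u.
Proof. by rewrite sqr_sqrtr ?dot_ge0. Qed.

Lemma enorm_eq1 u : enorm u = 1 <-> dot u u = 1.
Proof.
split=> [u1|]; first by rewrite -enorm_sqr u1 expr1n.
by rewrite /enorm => ->; rewrite sqrtr1.
Qed.

Lemma enormZ a u : enorm (a *: u) = `|a| * enorm u.
Proof.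
by rewrite /enorm dotZl dotZr mulrA -expr2 sqrtrM ?sqr_ge0// sqrtr_sqr.
Qed.

Lemma enorm_eq0 u : enorm u = 0 -> u = 0.
Proof.
move=> u0; have /eqP : dot u u = 0 by rewrite -enorm_sqr u0 expr0n.
rewrite psumr_eq0 => [/allP u00|i _]; last by rewrite -expr2 sqr_ge0.
apply/colP => i; rewrite mxE; apply/eqP.
by have := u00 i (mem_index_enum i); rewrite mulf_eq0 orbb.
Qed.

(** The estimates are carried out in the max norm, which is the norm of the
    normed module 'cV; this bound and [enorm_le_norm] translate between it and
    the Euclidean norm. *)
Lemma norm_le_enorm u : `|u| <= enorm u.
Proof.
apply: norm_mx_le => [|i j]; first exact: enorm_ge0.
rewrite ord1 -(ler_pXn2r (n := 2)) ?nnegrE ?enorm_ge0 ?normr_ge0//.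
rewrite enorm_sqr real_normK ?num_real// expr2 /dot (bigD1 i)//= lerDl.
by apply: sumr_ge0 => l _; rewrite -expr2 sqr_ge0.
Qed.

Lemma dot_bounded_bilinear : bounded_bilinear (@dot R d).
Proof.
split=> [v a u w|u a v w|].
- by rewrite dotDl dotZl.
- by rewrite dotDr dotZr.
exists d%:R => u v; rewrite (le_trans (ler_norm_sum _ _ _))//.
rewrite -mulrA -[X in X%:R]card_ord sum_le_card// => l.
by rewrite normrM ler_pM ?norm_coord_le.
Qed.

Lemma enorm_le_norm u : enorm u <= d%:R * `|u|.
Proof.
rewrite -(ler_pXn2r (n := 2)) ?nnegrE ?enorm_ge0 ?mulr_ge0// enorm_sqr.
rewrite exprMn !expr2.
apply: le_trans (sum_le_card (a := `|u| * `|u|) _) _ => [l|].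
  by rewrite (le_trans (ler_norm _))// normrM ler_pM ?norm_coord_le.
rewrite card_ord ler_wpM2r ?mulr_ge0//.
by rewrite -natrM ler_nat; case: (d) => // m; rewrite leq_pmulr.
Qed.

Lemma enorm_mulmx_le (A : 'M[R]_d) u : enorm (A *m u) <= opnorm A * enorm u.
Proof.
have [u0|u_neq0] := eqVneq (enorm u) 0.
  by rewrite (enorm_eq0 u0) mulmx0 /enorm !dot0l sqrtr0 mulr0.
have u_gt0 : 0 < enorm u by rewrite lt_neqAle eq_sym u_neq0 enorm_ge0.
rewrite -ler_pdivrMr// /opnorm; apply: ub_le_sup; last first.
  exists ((enorm u)^-1 *: u) => /=; first by
    rewrite enormZ gtr0_norm ?invr_gt0// mulVf.
  by rewrite -scalemxAr enormZ gtr0_norm ?invr_gt0// mulrC.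
have [K K0 BK] := bilinear_boundP (mulmx_bounded_bilinear (R := R) d d 1).
exists (d%:R * (K * (`|A| * 1))) => _ /= [w w1 <-].
rewrite (le_trans (enorm_le_norm _))// ler_wpM2l// BK//.
by rewrite -w1 norm_le_enorm.
Qed.

Lemma opnorm_ge0 (A : 'M[R]_d) : 0 <= opnorm A.
Proof.
have [[u u1]|no_unit] := pselect (exists u : 'cV[R]_d, enorm u = 1).
  by rewrite (le_trans (enorm_ge0 (A *m u)))// -[leRHS]mulr1 -u1 enorm_mulmx_le.
rewrite /opnorm (_ : [set _ | _ in _] = set0) ?sup0// -subset0 => _ /= [u u1 _].
by apply: no_unit; exists u.
Qed.

Lemma enorm_delta i : enorm (delta_mx i 0 : 'cV[R]_d) = 1.
Proof.
apply/enorm_eq1; rewrite /dot (bigD1 i)//= big1 => [|j ji].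
  by rewrite mxE !eqxx mulr1 addr0.
by rewrite mxE (negbTE ji) mul0r.
Qed.

Lemma norm_le_opnorm (A : 'M[R]_d) : `|A| <= opnorm A.
Proof.
apply: norm_mx_le => [|i j]; first exact: opnorm_ge0.
have := enorm_mulmx_le A (delta_mx j 0); rewrite enorm_delta mulr1.
apply: le_trans; rewrite (le_trans _ (norm_le_enorm _))//.
by rewrite -colE; have := norm_coord_le (col j A) i 0; rewrite mxE.
Qed.

End Euclid.

(** * First-order jets in the step size *)

Section Jets.
Context {R : realType} {C : Type} (D : set C) (h : C -> R).
Hypothesis h_gt0 : forall c, D c -> 0 < h c.

(** [C] is the type of the data of one step and [D] the set of admissible
    ones: being eventual is uniform over all data with small step size. *)
Definition eventually (P : C -> Prop) :=
  exists2 e : R, 0 < e & forall c, D c -> h c <= e -> P c.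

Lemma eventually_and (P Q : C -> Prop) :
  eventually P -> eventually Q -> eventually (fun c => P c /\ Q c).
Proof.
move=> [e e0 Pe] [e' e'0 Qe']; exists (Order.min e e').
  by rewrite lt_min e0.
by move=> c Dc; rewrite le_min => /andP[he he']; split; [exact: Pe|exact: Qe'].
Qed.

Lemma eventually_imp (P Q : C -> Prop) :
  (forall c, D c -> P c -> Q c) -> eventually P -> eventually Q.
Proof. by move=> PQ [e e0 Pe]; exists e => // c Dc he; exact/PQ/Pe. Qed.

Lemma eventually_forall (I : finType) (P : I -> C -> Prop) :
  (forall i, eventually (P i)) -> eventually (fun c => forall i, P i c).
Proof.
move=> evP.
have : eventually (fun c => forall i, i \in enum I -> P i c).
  elim: (enum I) => [|i s IHs]; first by exists 1.
  apply: eventually_imp (eventually_and (evP i) IHs) => c _ [Pi Ps] j.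
  by rewrite inE => /predU1P[->|/Ps].
by apply: eventually_imp => c _ Pc i; apply: Pc; rewrite mem_enum.
Qed.

Lemma eventually_le (e : R) : 0 < e -> eventually (fun c => h c <= e).
Proof. by move=> e0; exists e. Qed.

(** f = f0 + h f1 + O(h^2), uniformly over [D], with bounded coefficients. The
    coefficients may depend on the data, since they are evaluated at the state
    before the step. *)
Definition jet {V : normedModType R} (f f0 f1 : C -> V) :=
  exists M : R, eventually (fun c =>
    [/\ `|f0 c| <= M, `|f1 c| <= M
      & `|f c - (f0 c + h c *: f1 c)| <= M * h c ^+ 2]).

Lemma jet_eq {V : normedModType R} (f f0 f1 g g0 g1 : C -> V) :
  (forall c, D c -> f c = g c) -> (forall c, D c -> f0 c = g0 c) ->
  (forall c, D c -> f1 c = g1 c) -> jet f f0 f1 -> jet g g0 g1.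
Proof.
move=> fg fg0 fg1 [M evM]; exists M; apply: eventually_imp evM => c Dc.
by rewrite fg// fg0// fg1.
Qed.

Lemma jet_affine {V : normedModType R} (f0 f1 : C -> V) (M : R) :
  (forall c, D c -> `|f0 c| <= M) -> (forall c, D c -> `|f1 c| <= M) ->
  jet (fun c => f0 c + h c *: f1 c) f0 f1.
Proof.
move=> f0M f1M; exists M, 1 => // c Dc _; split; [exact: f0M|exact: f1M|].
by rewrite subrr normr0 mulr_ge0 ?sqr_ge0// (le_trans _ (f0M c Dc)).
Qed.

Lemma jet_cst {V : normedModType R} (v : V) : jet (fun=> v) (fun=> v) (fun=> 0).
Proof.
apply: (@jet_eq _ (fun c => v + h c *: 0)) (jet_affine (M := `|v|) _ _) => //.
  by move=> c _; rewrite scaler0 addr0.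
by move=> c _; rewrite normr0.
Qed.

Lemma jetD {V : normedModType R} (f f0 f1 g g0 g1 : C -> V) :
  jet f f0 f1 -> jet g g0 g1 ->
  jet (fun c => f c + g c) (fun c => f0 c + g0 c) (fun c => f1 c + g1 c).
Proof.
move=> [M evM] [K evK]; exists (M + K).
apply: eventually_imp (eventually_and evM evK) => c _ [[f0M f1M fM] [g0K g1K gK]].
split; [exact: le_normD|exact: le_normD|].
by rewrite scalerDr addrACA opprD addrACA mulrDl le_normD.
Qed.

Lemma jet_sum {V : normedModType R} (I : Type) (r : seq I) (P : pred I)
    (f f0 f1 : I -> C -> V) :
  (forall i, P i -> jet (f i) (f0 i) (f1 i)) ->
  jet (fun c => \sum_(i <- r | P i) f i c) (fun c => \sum_(i <- r | P i) f0 i c)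
      (fun c => \sum_(i <- r | P i) f1 i c).
Proof.
move=> fP; elim: r => [|i r IHr].
  by apply: jet_eq (jet_cst 0) => c _; rewrite big_nil.
case Pi : (P i); last by apply: jet_eq IHr => c _; rewrite big_cons Pi.
by apply: jet_eq (jetD (fP i Pi) IHr) => c _; rewrite big_cons Pi.
Qed.

(** The Leibniz rule. The remainder splits as
    B(f - P) g + B P (g - Q) + h^2 B f1 g1, where P and Q are the first-order
    expansions of f and g. *)
Lemma jet_bilinear {U V W : normedModType R} (B : U -> V -> W)
    (f f0 f1 : C -> U) (g g0 g1 : C -> V) :
  bounded_bilinear B -> jet f f0 f1 -> jet g g0 g1 ->
  jet (fun c => B (f c) (g c)) (fun c => B (f0 c) (g0 c))
      (fun c => B (f0 c) (g1 c) + B (f1 c) (g0 c)).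
Proof.
move=> bB [M evM] [N evN]; have [K K0 BK] := bilinear_boundP bB.
exists (K * (M * N) + K * (M * N) + K * (M * (3 * N)) + K * (2 * M * N)).
apply: eventually_imp
  (eventually_and (eventually_and evM evN) (eventually_le ltr01)).
move=> c Dc [[[f0M f1M fM] [g0N g1N gN]] h1]; have h0 := ltW (h_gt0 Dc).
have M0 : 0 <= M by exact: le_trans f0M.
have N0 : 0 <= N by exact: le_trans g0N.
have KMN : 0 <= K * (M * N) by rewrite !mulr_ge0.
set t := h c in h0 h1 fM gN *.
have t2 : t ^+ 2 <= 1 by rewrite expr_le1.
have Pf : `|f0 c + t *: f1 c| <= 2 * M.
  rewrite (_ : 2 * M = M + 1 * M); last by ring.
  by rewrite le_normD// normrZ ger0_norm// ler_pM.
have gN3 : `|g c| <= 3 * N.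
  rewrite -[g c](subrK (g0 c + t *: g1 c)).
  rewrite (_ : 3 * N = N * 1 + (N + 1 * N)); last by ring.
  rewrite le_normD//; first by rewrite (le_trans gN)// ler_wpM2l.
  by rewrite le_normD// normrZ ger0_norm// ler_pM.
split.
- rewrite (le_trans (BK _ _ _ _ f0M g0N))// -!addrA lerDl !addr_ge0// !mulr_ge0//.
- rewrite (le_trans (le_normD (BK _ _ _ _ f0M g1N) (BK _ _ _ _ f1M g0N)))//.
  by rewrite -[leRHS]addrA lerDl addr_ge0// !mulr_ge0.
rewrite (_ : _ - _ = B (f c - (f0 c + t *: f1 c)) (g c)
    + B (f0 c + t *: f1 c) (g c - (g0 c + t *: g1 c)) + t ^+ 2 *: B (f1 c) (g1 c)).
  have fb := BK _ _ _ _ fM gN3; have gb := BK _ _ _ _ Pf gN.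
  have hb : `|t ^+ 2 *: B (f1 c) (g1 c)| <= t ^+ 2 * (K * (M * N)).
    by rewrite normrZ ger0_norm ?sqr_ge0// ler_wpM2l ?sqr_ge0// BK.
  rewrite (le_trans (le_normD (le_normD fb gb) hb))//.
  have := mulr_ge0 KMN (sqr_ge0 t); lra.
rewrite (bilinearBl bB) (bilinearBr bB) !(bilinearPl bB, bilinearPr bB).
rewrite scalerDr scalerDr scalerA -expr2.
set a := B (f c) _; set b := B (f0 c) (g0 c).
set p := t *: _; set q := t *: B (f1 c) (g0 c); set s := t ^+ 2 *: _.
apply/esym; rewrite -addrA -addrA; congr (_ + _).
rewrite addrA addKr (_ : b + p + (q + s) = b + (p + q) + s) ?addrA//.
by rewrite opprD subrK.
Qed.

Lemma jet_lipschitz {V : normedModType R} (f f0 f1 : C -> V) :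
  jet f f0 f1 ->
  exists2 K : R, 0 <= K & eventually (fun c => `|f c - f0 c| <= K * h c).
Proof.
move=> [M evM]; exists (`|M| + `|M|); first by rewrite addr_ge0.
apply: eventually_imp (eventually_and evM (eventually_le ltr01)).
move=> c Dc [[_ f1M fM] h1]; have h0 := ltW (h_gt0 Dc).
have M0 : 0 <= M by exact: le_trans f1M.
rewrite ger0_norm//.
rewrite (_ : f c - f0 c = (f c - (f0 c + h c *: f1 c)) + h c *: f1 c).
  rewrite mulrDl le_normD//.
    by rewrite (le_trans fM)// ler_wpM2l// expr2 ler_piMr.
  by rewrite normrZ ger0_norm// mulrC ler_wpM2r.
by rewrite opprD addrA subrK.
Qed.

Lemma jet_near {V : normedModType R} (f f0 f1 : C -> V) (e : R) :
  0 < e -> jet f f0 f1 -> eventually (fun c => `|f c - f0 c| <= e).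
Proof.
move=> e0 /jet_lipschitz[K K0 evK].
have K1 : 0 < K + 1 by rewrite ltr_wpDl.
apply: eventually_imp (eventually_and evK (eventually_le (divr_gt0 e0 K1))).
move=> c Dc [fK]; rewrite ler_pdivlMr// => hK; have h0 := ltW (h_gt0 Dc).
rewrite (le_trans fK)// (le_trans _ hK)// mulrC ler_wpM2l// lerDl.
exact: ler01.
Qed.

(** With r = sqrt z the left-hand side is (r - 1)^2 (r + 2) / (2 r), while
    (z - 1)^2 = (r - 1)^2 (r + 1)^2; the bound follows as r is at least 1/2. *)
Lemma rsqrt_expansion (z : R) :
  `|z - 1| <= 1 / 2 ->
  `|(Num.sqrt z)^-1 - (1 - (z - 1) / 2)| <= 2 * (z - 1) ^+ 2.
Proof.
rewrite ler_norml => /andP[z_ge z_le].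
have z0 : 0 <= z by lra.
set r := Num.sqrt z; have rz : r ^+ 2 = z by rewrite sqr_sqrtr.
have r_ge0 : 0 <= r by exact: sqrtr_ge0.
have r_ge : 1 / 2 <= r by nra.
have r_gt0 : 0 < r by lra.
have s_gt0 : 0 < r^-1 by rewrite invr_gt0.
have s_le2 : r^-1 <= 2.
  by rewrite -(ler_pM2r r_gt0) mulVf ?gt_eqF//; lra.
have -> : r^-1 - (1 - (z - 1) / 2) = (r - 1) ^+ 2 * (r^-1 * (r + 2) / 2).
  by rewrite -rz; field; rewrite gt_eqF.
have r2_ge0 : 0 <= r^-1 * (r + 2) by rewrite mulr_ge0 ?(ltW s_gt0)//; lra.
have r2_le : r^-1 * (r + 2) <= 2 * (r + 2) by rewrite ler_wpM2r//; lra.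
rewrite ger0_norm; last by rewrite mulr_ge0 ?sqr_ge0// divr_ge0.
have -> : 2 * (z - 1) ^+ 2 = (r - 1) ^+ 2 * (2 * (r + 1) ^+ 2).
  by rewrite -rz; ring.
rewrite ler_wpM2l ?sqr_ge0//.
by have := sqr_ge0 r; rewrite sqrrD; lra.
Qed.

Lemma jet_rsqrt (f f1 : C -> R) :
  jet f (fun=> 1) f1 ->
  jet (fun c => (Num.sqrt (f c))^-1) (fun=> 1) (fun c => - (f1 c / 2)).
Proof.
move=> fj; have [K K0 evK] := jet_lipschitz fj; case: (fj) => M evM.
exists (2 * K ^+ 2 + `|M| + 1).
have e0 : 0 < 1 / 2 :> R by lra.
apply: eventually_imp (eventually_and evM (eventually_and evK (jet_near e0 fj))).
move=> c Dc [[_ f1M fM] [fK f_near]]; have h0 := ltW (h_gt0 Dc).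
have M0 : 0 <= M by exact: le_trans f1M.
have KK := sqr_ge0 K; have hh := sqr_ge0 (h c).
split.
- by rewrite normr1; have := normr_ge0 M; lra.
- by move: f1M; rewrite (ger0_norm M0) !ler_norml => /andP[? ?]; lra.
have -> : (Num.sqrt (f c))^-1 - (1 + h c *: - (f1 c / 2)) =
  ((Num.sqrt (f c))^-1 - (1 - (f c - 1) / 2))
  - (f c - (1 + h c *: f1 c)) / 2 by rewrite /GRing.scale/=; ring.
have fM2 : `|- ((f c - (1 + h c *: f1 c)) / 2)| <= M * h c ^+ 2 / 2.
  by move: fM; rewrite !ler_norml => /andP[? ?]; lra.
rewrite (le_trans (le_normD (rsqrt_expansion f_near) fM2))//.
have fK2 : (f c - 1) ^+ 2 <= K ^+ 2 * h c ^+ 2.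
  by rewrite -exprMn -real_normK ?num_real// ler_pXn2r ?nnegrE ?mulr_ge0.
rewrite (ger0_norm M0); have := mulr_ge0 M0 hh; lra.
Qed.

End Jets.

(** * Jets of an explicit Euler step and of a normalization *)

Section FrozenJets.
Context {R : realType} {C : Type} (D : set C) (h : C -> R).
Hypothesis h_gt0 : forall c, D c -> 0 < h c.
Local Notation jet := (jet D h).

(** A quantity that depends on the state before the step only: it is its own
    leading coefficient, so being frozen amounts to being bounded for small
    step sizes. *)
Definition frozen {V : normedModType R} (f : C -> V) := jet f f (fun=> 0).

Lemma frozen_bounded {V : normedModType R} (f : C -> V) (M : R) :
  (forall c, D c -> `|f c| <= M) -> frozen f.
Proof.
move=> fM; rewrite /frozen.
apply: (@jet_eq _ _ _ _ _ (fun c => f c + h c *: 0))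
  (jet_affine h (M := M) _ _) => //.
  by move=> c _; rewrite scaler0 addr0.
by move=> c Dc; rewrite normr0 (le_trans _ (fM c Dc)).
Qed.

Lemma frozenD {V : normedModType R} (f g : C -> V) :
  frozen f -> frozen g -> frozen (fun c => f c + g c).
Proof.
move=> fF gF; rewrite /frozen.
by apply: jet_eq (jetD fF gF) => c _ //; rewrite addr0.
Qed.

Lemma frozen_sum {V : normedModType R} (I : Type) (r : seq I) (P : pred I)
    (f : I -> C -> V) :
  (forall i, P i -> frozen (f i)) -> frozen (fun c => \sum_(i <- r | P i) f i c).
Proof.
move=> fF; rewrite /frozen.
by apply: jet_eq (jet_sum r fF) => c _ //; rewrite big1_eq.
Qed.

Lemma frozen_bilinear {U V W : normedModType R} (B : U -> V -> W)
    (f : C -> U) (g : C -> V) :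
  bounded_bilinear B -> frozen f -> frozen g -> frozen (fun c => B (f c) (g c)).
Proof.
move=> bB fF gF; rewrite /frozen.
apply: jet_eq (jet_bilinear h_gt0 bB fF gF) => c _ //.
have := bilinearBl bB 0 0 (g c); have := bilinearBr bB (f c) 0 0.
by rewrite !subrr => -> ->; rewrite addr0.
Qed.

Lemma jet_step {V : normedModType R} (f g : C -> V) :
  frozen f -> frozen g -> jet (fun c => f c + h c *: g c) f g.
Proof.
move=> fF gF.
have jh : jet h (fun=> 0) (fun=> 1 : R).
  exists 1, 1 => // c Dc _; rewrite normr0 normr1 ler01 lexx; split=> //.
  by rewrite add0r /GRing.scale/= mulr1 subrr normr0 mul1r sqr_ge0.
apply: jet_eq (jetD fF (jet_bilinear h_gt0 (scale_bounded_bilinear V) jh gF)).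
- by [].
- by move=> c _; rewrite scale0r addr0.
- by move=> c _; rewrite scale0r !add0r scale1r.
Qed.

Lemma jetB {V : normedModType R} (f f0 f1 g g0 g1 : C -> V) :
  jet f f0 f1 -> jet g g0 g1 ->
  jet (fun c => f c - g c) (fun c => f0 c - g0 c) (fun c => f1 c - g1 c).
Proof.
move=> fj gj; have m1 := jet_cst D h (-1 : R).
have := jetD fj (jet_bilinear h_gt0 (scale_bounded_bilinear V) m1 gj).
by apply: jet_eq => c _; rewrite ?scale0r ?addr0 scaleN1r.
Qed.

(** Normalizing removes from the velocity its component along the unit vector
    [w0]: this is the origin of the tangential projections in the continuous
    dynamics. *)
Lemma jet_normalize {d} (w w0 w1 : C -> 'cV[R]_d) :
  (forall c, D c -> dot (w0 c) (w0 c) = 1) -> jet w w0 w1 ->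
  jet (fun c => normalize (w c)) w0
      (fun c => w1 c - dot (w0 c) (w1 c) *: w0 c).
Proof.
move=> w0_unit wj.
have nj : jet (fun c => dot (w c) (w c)) (fun=> 1) (fun c => 2 * dot (w0 c) (w1 c)).
  apply: jet_eq (jet_bilinear h_gt0 dot_bounded_bilinear wj wj) => c Dc //.
    exact: w0_unit.
  by rewrite (dotC (w1 c)) mulr2n mulrDl mul1r.
apply: jet_eq
  (jet_bilinear h_gt0 (scale_bounded_bilinear _) (jet_rsqrt h_gt0 nj) wj).
- by [].
- by move=> c _; rewrite scale1r.
- by move=> c _; rewrite scale1r mulrC mulKf ?pnatr_eq0// scaleNr.
Qed.

Lemma jet_unit_neq0 {d} (w w0 w1 : C -> 'cV[R]_d) :
  (forall c, D c -> dot (w0 c) (w0 c) = 1) -> jet w w0 w1 ->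
  eventually D h (fun c => enorm (w c) != 0).
Proof.
move=> w0_unit wj.
have e0 : 0 < 1 / 2 :> R by lra.
have nj := jet_bilinear h_gt0 dot_bounded_bilinear wj wj.
apply: eventually_imp (jet_near h_gt0 e0 nj) => c Dc; rewrite w0_unit//.
apply: contraTneq => wc0; rewrite -ltNge -enorm_sqr wc0 expr0n/= sub0r normrN1.
by lra.
Qed.

End FrozenJets.

(** * Gram-Schmidt orthonormalization *)

Section GramSchmidt.
Context {R : realType} {d k : nat}.
Implicit Types (u : 'cV[R]_d) (w v : 'I_k -> 'cV[R]_d).

Lemma dot_normalize u : enorm u != 0 -> dot (normalize u) (normalize u) = 1.
Proof.
move=> u0; rewrite dotZl dotZr -enorm_sqr.
by rewrite expr2 mulKf// mulVf.
Qed.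

Lemma gram_schmidt_orthonormal w v :
  (forall i, v i = normalize (gram_schmidt_residual w v i)) ->
  (forall i, enorm (gram_schmidt_residual w v i) != 0) ->
  orthonormal_family v.
Proof.
move=> vE r_neq0.
have vv i : dot (v i) (v i) = 1 by rewrite vE dot_normalize.
have lower n (i l : 'I_k) : (i < n)%N -> (l < i)%N -> dot (v i) (v l) = 0.
  (* The residual cancels the component along v l exactly because the earlier
     vectors are already orthonormal; strong induction on the larger index. *)
  elim: n i l => // n IHn i l; rewrite ltnS => i_le li.
  rewrite [v i]vE dotZl (_ : dot _ (v l) = 0) ?mulr0//.
  rewrite dotBl dot_suml (bigD1 l)//= dotZl vv mulr1 big1 => [|j].
    by rewrite addr0 subrr.
  move=> /andP[ji jl]; rewrite dotZl (_ : dot (v j) (v l) = 0) ?mulr0//.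
  have [jl_lt|lj_lt|jl_eq] := ltngtP j l.
  - by rewrite dotC IHn// (leq_trans li).
  - by rewrite IHn// (leq_trans ji).
  - by rewrite (val_inj jl_eq) eqxx in jl.
move=> i j; have [ij|ji|/val_inj->] := ltngtP i j; last by rewrite eqxx vv.
- by rewrite dotC (lower j.+1)// lt_eqF//.
- by rewrite (lower i.+1)// gt_eqF.
Qed.

Lemma gram_schmidt_orthogonal w v u :
  (forall i, v i = normalize (gram_schmidt_residual w v i)) ->
  (forall i, dot (w i) u = 0) -> forall i, dot (v i) u = 0.
Proof.
move=> vE wu.
have : forall n (i : 'I_k), (i < n)%N -> dot (v i) u = 0; last first.
  by move=> vu i; exact: (vu i.+1).
elim=> // n IHn i; rewrite ltnS => i_le.
rewrite vE dotZl dotBl wu dot_suml big1 => [|j ji]; first by rewrite subrr mulr0.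
by rewrite dotZl IHn ?mulr0// (leq_trans ji).
Qed.

End GramSchmidt.

(** * The right-hand sides on the constraint manifold *)

Section RightHandSides.
Context {R : realType} {d k : nat}.
Variables (F : 'cV[R]_d -> 'cV[R]_d) (J : 'cV[R]_d -> 'M[R]_d).
Implicit Types (x : 'cV[R]_d) (v : 'I_k -> 'cV[R]_d).

Lemma reflect_mulmx (P : pred 'I_k) v (u : 'cV[R]_d) :
  (\sum_(j < k | P j) v j *m (v j)^T) *m u = \sum_(j < k | P j) dot (v j) u *: v j.
Proof. by rewrite mulmx_suml; apply: eq_bigr => j _; rewrite outer_mulmx. Qed.

(** The gradient flow reversed along the unstable directions v_j: the velocity
    of [x] before it is made tangent to the sphere. *)
Definition reflected_force x v : 'cV[R]_d :=
  F x - 2 *: \sum_j dot (v j) (F x) *: v j.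

Lemma pre_xE tau x v : pre_x F tau x v = x + tau *: reflected_force x v.
Proof. by rewrite /pre_x mulmxBl mul1mx -scalemxAl reflect_mulmx. Qed.

Lemma chisd_rhs_xE x v :
  chisd_rhs_x F x v = reflected_force x v - dot x (F x) *: x.
Proof.
by rewrite /chisd_rhs_x mulmxBl mul1mx -scalemxAl reflect_mulmx outer_mulmx.
Qed.

Lemma chisd_rhs_vE x v i :
  chisd_rhs_v F J x v i =
  J x *m v i - dot (v i) (J x *m v i) *: v i
  - 2 *: \sum_(j < k | (j < i)%N) dot (v j) (J x *m v i) *: v j
  - dot x (J x *m v i) *: x + dot (v i) (F x) *: x.
Proof.
rewrite /chisd_rhs_v -!mulmxA !mulmxBl mul1mx -!scalemxAl reflect_mulmx.
by rewrite outer_mulmx (mulmxA x) outer_mulmx.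
Qed.

Definition on_manifold x v :=
  [/\ dot x x = 1, orthonormal_family v & forall i, dot (v i) x = 0].

Lemma dot_sum_orthonormal (P : pred 'I_k) v (a : 'I_k -> R) i :
  orthonormal_family v ->
  dot (v i) (\sum_(j < k | P j) a j *: v j) = if P i then a i else 0.
Proof.
move=> v_on; rewrite dot_sumr; case: ifPn => Pi.
  rewrite (bigD1 i)//= dotZr v_on eqxx mulr1 big1 ?addr0// => j /andP[_ ji].
  by rewrite dotZr v_on eq_sym (negbTE ji) mulr0.
rewrite big1// => j Pj; rewrite dotZr v_on.
case: eqP => [ij|_]; last by rewrite mulr0.
by rewrite ij Pj in Pi.
Qed.

Lemma dot_sum_orthogonal (P : pred 'I_k) v x (a : 'I_k -> R) :
  (forall i, dot (v i) x = 0) -> dot (\sum_(j < k | P j) a j *: v j) x = 0.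
Proof. by move=> vx; rewrite dot_suml big1// => j _; rewrite dotZl vx mulr0. Qed.

Lemma dot_reflected_force_x x v : on_manifold x v ->
  dot x (reflected_force x v) = dot x (F x).
Proof.
move=> [_ _ vx]; rewrite dotBr dotZr [dot x (\sum_ _ _)]dotC.
by rewrite dot_sum_orthogonal// mulr0 subr0.
Qed.

Lemma dot_rhs_x x v i : on_manifold x v ->
  dot (v i) (chisd_rhs_x F x v) = - dot (v i) (F x).
Proof.
move=> [_ v_on vx]; rewrite chisd_rhs_xE dotBr dotZr vx mulr0 subr0.
by rewrite dotBr dotZr dot_sum_orthonormal//; ring.
Qed.

(** For j < i the sum over l < j in the equation of v_j is orthogonal to v_i, so
    that only the term J(x) v_j is seen by v_i. *)
Lemma dot_rhs_v x v (i j : 'I_k) : on_manifold x v -> (j < i)%N ->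
  dot (v i) (chisd_rhs_v F J x v j) = dot (v i) (J x *m v j).
Proof.
move=> [_ v_on vx] ji; rewrite chisd_rhs_vE !(dotDr, dotNr, dotZr) vx.
rewrite v_on dot_sum_orthonormal// ifF; last first.
  by apply/negbTE; rewrite -leqNgt ltnW.
rewrite (_ : (i == j) = false); last by rewrite -val_eqE gtn_eqF.
by rewrite !mulr0 !subr0 addr0.
Qed.

End RightHandSides.

(** * Expansion of one step of the scheme *)

Section SchemeExpansion.
Context {R : realType} {d k : nat}.
Variables (F : 'cV[R]_d -> 'cV[R]_d) (J : 'cV[R]_d -> 'M[R]_d).
Hypothesis J_sym : forall x, (J x)^T = J x.
Variables (MF MJ : R).
Hypothesis F_bounded : forall x : 'cV[R]_d, `|x| <= 1 -> `|F x| <= MF.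
Hypothesis J_bounded : forall x : 'cV[R]_d, `|x| <= 1 -> `|J x| <= MJ.

Record step_data := StepData {
  stepsize : R;
  old_x : 'cV[R]_d; old_v : 'I_k -> 'cV[R]_d;
  new_x : 'cV[R]_d; new_v : 'I_k -> 'cV[R]_d }.

Definition manifold_step : set step_data := [set c |
  [/\ 0 < stepsize c, on_manifold (old_x c) (old_v c)
    & chisd_step F J (stepsize c) (old_x c) (old_v c) (new_x c) (new_v c)]].

Let D := manifold_step.
Let h := stepsize.
Local Notation jet := (jet D h).
Local Notation frozen := (frozen D h).

Let h_gt0 c : D c -> 0 < h c. Proof. by case. Qed.

Let unit_le1 (u : 'cV[R]_d) : dot u u = 1 -> `|u| <= 1.
Proof. by move=> u1; rewrite (le_trans (norm_le_enorm u))// (enorm_eq1 u).2. Qed.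

Let frozen_x : frozen old_x.
Proof.
by apply: (frozen_bounded h (M := 1)) => c [_ [x1 _ _] _]; exact: unit_le1.
Qed.

Let frozen_v i : frozen (fun c => old_v c i).
Proof.
apply: (frozen_bounded h (M := 1)) => c [_ [_ v_on _] _].
by apply: unit_le1; rewrite v_on eqxx.
Qed.

Let frozen_F : frozen (fun c => F (old_x c)).
Proof.
apply: (frozen_bounded h (M := MF)) => c [_ [x1 _ _] _].
exact/F_bounded/unit_le1.
Qed.

Let frozen_Jv i : frozen (fun c => J (old_x c) *m old_v c i).
Proof.
apply: (frozen_bilinear h_gt0 (mulmx_bounded_bilinear _ _ _)  _ (frozen_v i)).
apply: (frozen_bounded h (M := MJ)) => c [_ [x1 _ _] _].
exact/J_bounded/unit_le1.
Qed.

Let frozen_scale (V : normedModType R) (a : step_data -> R) (f : step_data -> V) :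
  frozen a -> frozen f -> frozen (fun c => a c *: f c).
Proof.
move=> aF fF.
exact: (frozen_bilinear h_gt0 (scale_bounded_bilinear V) aF fF).
Qed.

Let jet_scale (V : normedModType R) (a a0 a1 : step_data -> R)
    (f f0 f1 : step_data -> V) :
  jet a a0 a1 -> jet f f0 f1 ->
  jet (fun c => a c *: f c) (fun c => a0 c *: f0 c)
      (fun c => a0 c *: f1 c + a1 c *: f0 c).
Proof.
move=> aj fj.
exact: (jet_bilinear h_gt0 (scale_bounded_bilinear V) aj fj).
Qed.

Let frozen_reflected_force :
  frozen (fun c => reflected_force F (old_x c) (old_v c)).
Proof.
have sum_frozen : frozen (fun c =>
    \sum_j dot (old_v c j) (F (old_x c)) *: old_v c j).
  apply: frozen_sum => j _; apply: frozen_scale => //.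
  exact: (frozen_bilinear h_gt0 dot_bounded_bilinear (frozen_v j) frozen_F).
have := frozenD frozen_F (frozen_scale (jet_cst D h (-2 : R)) sum_frozen).
by apply: jet_eq => c _; rewrite ?scaleNr.
Qed.

Let jet_pre_x : jet (fun c => pre_x F (h c) (old_x c) (old_v c)) old_x
  (fun c => reflected_force F (old_x c) (old_v c)).
Proof.
have := jet_step h_gt0 frozen_x frozen_reflected_force.
by apply: jet_eq => c _ //; rewrite pre_xE.
Qed.

Let old_x_unit c : D c -> dot (old_x c) (old_x c) = 1.
Proof. by case=> _ []. Qed.

Let old_v_unit i c : D c -> dot (old_v c i) (old_v c i) = 1.
Proof. by case=> _ [_ v_on _] _; rewrite v_on eqxx. Qed.

Lemma jet_new_x :
  jet new_x old_x (fun c => chisd_rhs_x F (old_x c) (old_v c)).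
Proof.
apply: jet_eq (jet_normalize h_gt0 old_x_unit jet_pre_x) => c [_ Mc [xE _]] //.
by rewrite chisd_rhs_xE dot_reflected_force_x.
Qed.

(** The component of the updated v_i along the new x is
    tau (x . J v_i + v_i . G) + O(tau^2), where G is the velocity of x, and
    v_i . G = - v_i . F because of the reflection; subtracting it produces the
    term x (v_i . F) of the dynamics. *)
Let jet_proj_v i :
  jet (fun c => proj_v J (h c) (old_x c) (old_v c) (new_x c) i)
      (fun c => old_v c i)
      (fun c => J (old_x c) *m old_v c i
        - dot (old_x c) (J (old_x c) *m old_v c i) *: old_x c
        + dot (old_v c i) (F (old_x c)) *: old_x c).
Proof.
have vj := jet_step h_gt0 (frozen_v i) (frozen_Jv i).
have dj := jet_bilinear h_gt0 dot_bounded_bilinear vj jet_new_x.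
apply: jet_eq (jetB h_gt0 vj (jet_scale dj jet_new_x)) => c [_ Mc _] //.
  by case: Mc => _ _ ->; rewrite scale0r subr0.
rewrite dot_rhs_x//; case: Mc => _ _ ->.
rewrite scale0r add0r (dotC _ (old_x c)) scalerDl scaleNr opprD opprK.
by rewrite addrA addrAC.
Qed.

(** The component along a new v_j, j < i, receives v_j . J v_i from the motion
    of v_i and v_i . J v_j from the motion of v_j. They are equal because J is
    symmetric, hence the coefficient 2. *)
Let jet_residual (i : 'I_k) :
  (forall j : 'I_k, (j < i)%N -> jet (fun c => new_v c j) (fun c => old_v c j)
    (fun c => chisd_rhs_v F J (old_x c) (old_v c) j)) ->
  jet (fun c => gram_schmidt_residual
        (proj_v J (h c) (old_x c) (old_v c) (new_x c)) (new_v c) i)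
      (fun c => old_v c i)
      (fun c => J (old_x c) *m old_v c i
        - dot (old_x c) (J (old_x c) *m old_v c i) *: old_x c
        + dot (old_v c i) (F (old_x c)) *: old_x c
        - 2 *: \sum_(j < k | (j < i)%N)
            dot (old_v c j) (J (old_x c) *m old_v c i) *: old_v c j).
Proof.
move=> IH; have pj := jet_proj_v i.
have sj := jet_sum (index_enum 'I_k) (P := fun j : 'I_k => (j < i)%N)
  (fun j ji => jet_scale
    (jet_bilinear h_gt0 dot_bounded_bilinear pj (IH j ji)) (IH j ji)).
apply: jet_eq (jetB h_gt0 pj sj) => c [_ Mc _] //.
  rewrite big1 ?subr0// => j ji; case: Mc => _ -> _.
  by rewrite -val_eqE gtn_eqF// scale0r.
congr (_ - _); rewrite scaler_sumr; apply: eq_bigr => j ji.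
rewrite dot_rhs_v// (dotC (old_v c i) (J _ *m _)) dot_sym_mx//.
case: (Mc) => x1 v_on vx; rewrite v_on -val_eqE gtn_eqF// scale0r add0r.
rewrite scalerA; congr (_ *: _).
rewrite [in X in _ + X]dotC !(dotDr, dotNr, dotZr) (vx j) [dot _ (old_v c j)]dotC.
by ring.
Qed.

Lemma jet_new_v i : jet (fun c => new_v c i) (fun c => old_v c i)
  (fun c => chisd_rhs_v F J (old_x c) (old_v c) i).
Proof.
have : forall n (i : 'I_k), (i < n)%N -> jet (fun c => new_v c i)
  (fun c => old_v c i) (fun c => chisd_rhs_v F J (old_x c) (old_v c) i); last first.
  by move=> /(_ i.+1); exact.
elim=> // n IHn {}i; rewrite ltnS => i_le.
have rj := jet_residual (fun j ji => IHn j (leq_trans ji i_le)).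
apply: jet_eq (jet_normalize h_gt0 (old_v_unit i) rj) => c [_ Mc [_ vE]] //.
rewrite chisd_rhs_vE; case: Mc => x1 v_on vx.
rewrite !(dotDr, dotNr, dotZr) vx dot_sum_orthonormal// ltnn.
rewrite !mulr0 subr0 addr0 subr0.
set a := J _ *m _; set b := dot _ a *: old_x c; set e := dot _ (F _) *: _.
set s := 2 *: _; set p := dot _ a *: old_v c i.
by rewrite [LHS](ACl (1*5*4*2*3)).

Qed.

(** Gram-Schmidt and normalization give exact constraints as soon as nothing
    degenerates; the vectors to be normalized are close to unit ones, since
    they have unit leading coefficients. *)
Lemma manifold_preserved :
  eventually D h (fun c => on_manifold (new_x c) (new_v c)).
Proof.
have ex := jet_unit_neq0 h_gt0 old_x_unit jet_pre_x.
have er := eventually_forall (fun i =>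
  jet_unit_neq0 h_gt0 (old_v_unit i) (jet_residual (fun j _ => jet_new_v j))).
apply: eventually_imp (eventually_and ex er) => c [_ _ [xE vE]] [x_neq0 r_neq0].
have x_unit : dot (new_x c) (new_x c) = 1 by rewrite xE dot_normalize.
split=> //; first exact: gram_schmidt_orthonormal vE r_neq0.
apply: gram_schmidt_orthogonal vE _ => i.
by rewrite dotBl dotZl x_unit mulr1 subrr.
Qed.

End SchemeExpansion.

(** * Convergence of one-step methods *)

Section MeanValue.
Context {R : realType} {m n : nat}.
Implicit Types (f : R -> 'M[R]_(m, n)).

Lemma is_derive_coord f (t : R) (l : 'M[R]_(m, n)) i j :
  is_derive t 1 f l -> is_derive t 1 (fun s => f s i j) (l i j).
Proof.
move=> [df <-]; have /derivable_mxP dfij := df.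
by split=> //; rewrite derive_mx// mxE.
Qed.

(** The mean value theorem fails for vector-valued maps, but holds in each
    coordinate, and the max norm only sees coordinates. *)
Lemma mean_value_mx f f' (a b e : R) (w : 'M[R]_(m, n)) :
  a <= b -> 0 <= e -> {within `[a, b], continuous f} ->
  (forall t, a < t < b -> is_derive t 1 f (f' t)) ->
  (forall t, a < t < b -> `|f' t - w| <= e) ->
  `|f b - f a - (b - a) *: w| <= (b - a) * e.
Proof.
rewrite le_eqVlt => /predU1P[->|ab] e0 cf df f'e.
  by rewrite !subrr scale0r subrr normr0 mul0r.
apply: norm_mx_le => [|i j]; first by rewrite mulr_ge0// subr_ge0 ltW.
have dfij t : t \in `]a, b[%R -> is_derive t 1 (fun s => f s i j) (f' t i j).
  by rewrite in_itv/= => /df; exact: is_derive_coord.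
have cfij : {within `[a, b], continuous (fun s => f s i j)}.
  apply: (within_continuous_comp _ _ (fun A : 'M[R]_(m, n) => A i j) _ cf).
  by move=> A _; exact: coord_continuous.
have [c] := MVT ab dfij cfij; rewrite in_itv/= => abc fE.
rewrite !mxE fE mulrC -mulrBr normrM ger0_norm ?subr_ge0 ?(ltW ab)//.
rewrite ler_wpM2l ?subr_ge0 ?(ltW ab)// (le_trans _ (f'e c abc))//.
by have := norm_coord_le (f' c - w) i j; rewrite !mxE.
Qed.

End MeanValue.

Section OneStepConvergence.
Context {R : realType} {d : nat} {I : finType}.
Local Notation state := (I -> 'cV[R]_d).
Implicit Types s : state.

Definition in_box (r : R) s := forall i, `|s i| <= r.
Definition state_dist s s' : R := \sum_i `|s i - s' i|.

Lemma state_dist_ge0 s s' : 0 <= state_dist s s'.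
Proof. exact: sumr_ge0. Qed.

Lemma coord_le_state_dist s s' i : `|s i - s' i| <= state_dist s s'.
Proof. by rewrite /state_dist (bigD1 i)//= lerDl sumr_ge0. Qed.

Variables (G : state -> state) (M Lip : R).
Hypotheses (M_ge0 : 0 <= M) (Lip_ge0 : 0 <= Lip).
Hypothesis G_bounded : forall s i, in_box 2 s -> `|G s i| <= M.
Hypothesis G_lipschitz : forall s s' i, in_box 2 s -> in_box 2 s' ->
  `|G s i - G s' i| <= Lip * state_dist s s'.

Definition ode_solution (T : R) (y : R -> state) :=
  (forall i, {within `[0, T], continuous (fun t => y t i)}) /\
  (forall t i, 0 < t < T -> is_derive t 1 (fun r => y r i) (G (y t) i)).

Section Trajectory.
Variables (T : R) (y : R -> state).
Hypothesis y_sol : ode_solution T y.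

Lemma ode_increment (a b e : R) (i : I) (w : 'cV[R]_d) :
  0 <= a -> a <= b -> b <= T -> 0 <= e ->
  (forall t, a < t < b -> `|G (y t) i - w| <= e) ->
  `|y b i - y a i - (b - a) *: w| <= (b - a) * e.
Proof.
move=> a0 ab bT e0; have [y_cont y_der] := y_sol.
apply: (mean_value_mx (f := fun t => y t i)) => //.
  apply: continuous_subspaceW (y_cont i) => t /=; rewrite !in_itv/=.
  by move=> /andP[at_ tb]; rewrite (le_trans a0)// (le_trans tb).
move=> t /andP[at_ tb]; apply: y_der.
by rewrite (le_lt_trans a0)// (lt_le_trans tb).
Qed.

Lemma ode_move_le (a b : R) (i : I) : 0 <= a -> a <= b -> b <= T ->
  (forall t, a < t < b -> in_box 2 (y t)) -> `|y b i - y a i| <= (b - a) * M.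
Proof.
move=> a0 ab bT y_box; rewrite -[y b i - y a i]subr0 -(scaler0 _ (b - a)).
by apply: ode_increment => // t /y_box/G_bounded; rewrite subr0.
Qed.

(** First exit: at the infimum of the times spent outside the box, the
    trajectory has moved by less than 1/2, so it is still in the open box and
    remains there for a while. *)
Lemma ode_stays_in_box (a b : R) : 0 <= a -> b <= T ->
  in_box (3 / 2) (y a) -> (b - a) * M < 1 / 2 ->
  forall t, a <= t <= b -> in_box 2 (y t).
Proof.
move=> a0 bT ya Mba t0 /andP[at0 t0b] i0; rewrite leNgt; apply/negP => yt0.
pose E : set R := [set t | a <= t <= b /\ exists i, 2 < `|y t i|].
have Et0 : E t0 by split; [rewrite at0|exists i0].
have E_lb : has_lbound E by exists a => t [/andP[]].
have t1_le t : E t -> inf E <= t by exact: ge_inf.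
have at1 : a <= inf E by apply: lb_le_inf => [|t [/andP[]]//]; exists t0.
have t1b : inf E <= b by rewrite (le_trans (t1_le _ Et0)).
set t1 := inf E in t1_le at1 t1b.
have before t : a < t < t1 -> in_box 2 (y t).
  move=> /andP[at_ tt1] i; rewrite leNgt; apply/negP => yti.
  suff /t1_le : E t by rewrite leNgt tt1.
  by split; [rewrite ltW//= (le_trans (ltW tt1))|exists i].
have t1T : t1 <= T by exact: le_trans bT.
have yt1 i : `|y t1 i| < 2.
  have := ode_move_le i a0 at1 t1T before; have := ya i.
  have : (t1 - a) * M <= (b - a) * M by rewrite ler_wpM2r// lerB.
  have := ler_normD (y t1 i - y a i) (y a i); rewrite subrK; lra.
have : \forall t \near within `[0, T]%classic (nbhs t1), forall i, `|y t i| < 2.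
  apply: filter_forall => i; have /subspace_continuousP := y_sol.1 i.
  move=> /(_ t1); rewrite /= in_itv/= (le_trans a0)// t1T => /(_ isT) yc.
  exact: cvgr_norm_lt yc _ (yt1 i).
move=> /nbhs_ballP[e /= e0 near_t1].
have [|t Et tt1] := inf_adherent e0 (E := E); first by split=> //; exists t0.
have [/andP[at_ tb] [i]] := Et; apply/negP; rewrite -leNgt ltW//.
apply: near_t1; last by rewrite in_itv/= (le_trans a0)// (le_trans tb).
rewrite /ball/= ler0_norm ?subr_le0 ?t1_le// opprB ltrBlDl; exact: tt1.
Qed.

Lemma ode_local_error (a b : R) (i : I) : 0 <= a -> a <= b -> b <= T ->
  (forall t, a <= t <= b -> in_box 2 (y t)) ->
  `|y b i - y a i - (b - a) *: G (y a) i| <=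
     Lip * (#|I|%:R * M) * (b - a) ^+ 2.
Proof.
move=> a0 ab bT y_box.
rewrite (_ : Lip * _ * _ = (b - a) * (Lip * (#|I|%:R * ((b - a) * M)))); last first.
  by ring.
have ba0 : 0 <= b - a by rewrite subr_ge0.
apply: ode_increment => // [|t /andP[at_ tb]]; first by rewrite !mulr_ge0.
have tab : a <= t <= b by rewrite !ltW.
rewrite (le_trans (G_lipschitz i (y_box t tab) (y_box a _)))//; first by
  rewrite lexx.
rewrite ler_wpM2l// sum_le_card// => j.
rewrite (le_trans (ode_move_le j a0 (ltW at_) _ _)) ?(le_trans (ltW tb))//.
  move=> r /andP[ar rt]; apply: y_box.
  by rewrite !ltW// (lt_trans rt).
by rewrite ler_wpM2r// lerB// ltW.
Qed.

End Trajectory.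

(** Boundedness of the trajectory and the error estimate are proved together:
    at time n tau the estimate puts the trajectory within 1/2 of a discrete
    state of the unit box, and [ode_stays_in_box] keeps it in the box of radius
    2, where the field is Lipschitz, up to time (n + 1) tau. *)
Theorem one_step_convergence (T C : R) : 0 < T -> 0 <= C ->
  exists tau0 Q : R, 0 < tau0 /\ 0 < Q /\
    forall y, ode_solution T y ->
    forall N : nat, (0 < N)%N -> let tau := T / N%:R in tau <= tau0 ->
    forall s : nat -> state, s 0%N = y 0 ->
    (forall n, (n <= N)%N -> in_box 1 (s n)) ->
    (forall n i, (n < N)%N ->
       `|s n.+1 i - s n i - tau *: G (s n) i| <= C * tau ^+ 2) ->
    forall n, (n <= N)%N -> state_dist (s n) (y (n%:R * tau)) <= Q * tau.
Proof.
move=> T_gt0 C_ge0.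
pose a := #|I|%:R * Lip; have a_ge0 : 0 <= a by rewrite mulr_ge0.
pose K := #|I|%:R * (C + Lip * (#|I|%:R * M)).
have K_ge0 : 0 <= K by rewrite mulr_ge0// addr_ge0// !mulr_ge0.
pose Q := K * T * expR (a * T) + 1.
have KT_ge0 : 0 <= K * T by exact: mulr_ge0 K_ge0 (ltW T_gt0).
have Q_gt0 : 0 < Q by rewrite ltr_wpDl//; exact: mulr_ge0 KT_ge0 (expR_ge0 _).
(* The first bound makes the error at most 1/2, the second one makes the
   motion during one step less than 1/2. *)
pose tau0 := Order.min (1 / 2 / Q) (1 / 2 / (M + 1)).
have M1_gt0 : 0 < M + 1 by rewrite ltr_wpDl.
have tau0_gt0 : 0 < tau0 by rewrite lt_min !divr_gt0.
exists tau0, Q; split=> //; split=> // y y_sol N N_gt0 tau.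
rewrite le_min !ler_pdivlMr// => /andP[tauQ tauM] s s0 s_box s_step.
have tau_gt0 : 0 < tau by rewrite divr_gt0// ltr0n.
have tau_ge0 := ltW tau_gt0.
have NT : N%:R * tau = T by rewrite mulrC divfK// pnatr_eq0 -lt0n.
(* This sequence absorbs the recursion e' <= (1 + a tau) e + K tau^2, as
   1 + a tau <= exp (a tau). *)
pose err n := K * n%:R * tau ^+ 2 * expR (a * (n%:R * tau)).
have nT n : (n <= N)%N -> n%:R * tau <= T.
  by move=> nN; rewrite -NT ler_wpM2r// ler_nat.
have errQ n : (n <= N)%N -> err n <= Q * tau.
  move=> nN; have nTn := nT _ nN.
  have : err n <= K * T * tau * expR (a * T).
    rewrite /err (_ : K * n%:R * tau ^+ 2 = K * (n%:R * tau) * tau); last by ring.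
    apply: ler_pM; last by rewrite ler_expR ler_wpM2l.
    - by apply: mulr_ge0 => //; apply: mulr_ge0 => //; exact: mulr_ge0.
    - exact: expR_ge0.
    - by rewrite ler_wpM2r// ler_wpM2l.
  by move=> /le_trans; apply; rewrite /Q mulrDl mul1r mulrAC lerDl.
suff dist_err n : (n <= N)%N -> state_dist (s n) (y (n%:R * tau)) <= err n.
  by move=> n nN; exact: le_trans (dist_err n nN) (errQ n nN).
elim: n => [_|n IHn nN].
  rewrite mul0r s0 /state_dist big1 => [|i _]; first by
    rewrite /err mulr0 !mul0r.
  by rewrite subrr normr0.
have nN' := ltnW nN; have {}IHn := IHn nN'.
have tn_ge0 : 0 <= n%:R * tau by rewrite mulr_ge0.
have tnS : n.+1%:R * tau - n%:R * tau = tau by rewrite -natr1; ring.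
have tnT := nT _ nN.
have tn_le : n%:R * tau <= n.+1%:R * tau by rewrite ler_wpM2r// ler_nat.
have y_near : in_box (3 / 2) (y (n%:R * tau)).
  move=> i; have := coord_le_state_dist (s n) (y (n%:R * tau)) i.
  have := le_trans IHn (errQ n nN'); have := s_box n nN' i.
  have := ler_normB (s n i) (s n i - y (n%:R * tau) i).
  rewrite opprB addrC subrK; lra.
have y_box := ode_stays_in_box y_sol tn_ge0 tnT y_near.
have {}y_box : forall t, n%:R * tau <= t <= n.+1%:R * tau -> in_box 2 (y t).
  by apply: y_box; rewrite tnS; lra.
have s_box2 : in_box 2 (s n) by move=> i; have := s_box n nN' i; lra.
have y_box2 : in_box 2 (y (n%:R * tau)) by apply: y_box; rewrite lexx.
set yn := y (n%:R * tau) in IHn y_near y_box2 *.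
have step i : `|s n.+1 i - y (n.+1%:R * tau) i| <=
    `|s n i - yn i| + (tau * (Lip * state_dist (s n) yn)
      + (C + Lip * (#|I|%:R * M)) * tau ^+ 2).
  have := ode_local_error y_sol i tn_ge0 tn_le tnT y_box; rewrite tnS -/yn => e1.
  have e2 := s_step n i nN; have e3 := G_lipschitz i s_box2 y_box2.
  have {}e3 : `|tau *: (G (s n) i - G yn i)| <= tau * (Lip * state_dist (s n) yn).
    by rewrite normrZ ger0_norm// ler_wpM2l.
  rewrite -normrN in e1.
  have -> : s n.+1 i - y (n.+1%:R * tau) i = (s n i - yn i)
      + tau *: (G (s n) i - G yn i) + ((s n.+1 i - s n i - tau *: G (s n) i)
      + - (y (n.+1%:R * tau) i - yn i - tau *: G yn i)).
    by apply/colP => r; rewrite !mxE; ring.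
  rewrite (le_trans (le_normD (le_normD (lexx _) e3) (le_normD e2 e1)))//.
  by rewrite -mulrDl addrA.
have step_sum : state_dist (s n.+1) (y (n.+1%:R * tau)) <=
    (1 + a * tau) * state_dist (s n) yn + K * tau ^+ 2.
  rewrite /state_dist (le_trans (ler_sum _ (fun i _ => step i)))//.
  rewrite big_split/= sumr_const -[X in _ + X]mulr_natl /K /a -/(state_dist _ _).
  by rewrite le_eqVlt; apply/orP; left; apply/eqP; ring.
rewrite (le_trans step_sum)// /err.
have exp_ge : 1 + a * tau <= expR (a * tau) by exact: expR_ge1Dx.
have -> : expR (a * (n.+1%:R * tau)) = expR (a * tau) * expR (a * (n%:R * tau)).
  by rewrite -expRD -natr1; congr expR; ring.
have e_ge1 : 1 <= expR (a * tau) * expR (a * (n%:R * tau)).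
  rewrite -expRD -[leLHS]expR0 ler_expR.
  exact: addr_ge0 (mulr_ge0 a_ge0 tau_ge0) (mulr_ge0 a_ge0 tn_ge0).
have Kt_ge0 : 0 <= K * tau ^+ 2 by exact: mulr_ge0 K_ge0 (sqr_ge0 _).
have h1 : (1 + a * tau) * state_dist (s n) yn <= expR (a * tau) * err n.
  apply: ler_pM => //; first exact: addr_ge0 ler01 (mulr_ge0 a_ge0 tau_ge0).
  exact: state_dist_ge0.
have h2 : K * tau ^+ 2 <=
    K * tau ^+ 2 * (expR (a * tau) * expR (a * (n%:R * tau))) by rewrite ler_peMr.
rewrite (le_trans (lerD h1 h2))// le_eqVlt; apply/orP; left; apply/eqP.
by rewrite /err -natr1; ring.
Qed.

End OneStepConvergence.

(** * Symmetry of the Hessian *)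

Section MixedDerivatives.
Context {R : realType}.

Lemma is_derive_line {V W : normedModType R} (f : V -> W) (p u : V) (s : R) :
  derivable f (p + s *: u) u ->
  is_derive s 1 (fun r : R => f (p + r *: u)) ('D_u f (p + s *: u)).
Proof.
have E : (fun h : R => h^-1 *: (((fun r : R => f (p + r *: u)) \o shift s) (h *: 1)
    - f (p + s *: u))) =
  (fun h : R => h^-1 *: ((f \o shift (p + s *: u)) (h *: u) - f (p + s *: u))).
  apply/funext => h /=; congr (_ *: (f _ - _)).
  have -> : h *: (1 : R) = h by rewrite -[RHS]mulr1.
  by rewrite scalerDl addrCA.
by move=> df; split; rewrite /derivable /derive E.
Qed.

(** Two applications of the mean value theorem, first along [u], then along
    [v]. *)
Lemma second_difference {V : normedModType R} (f : V -> R) (p u v : V) (h : R) :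
  0 < h -> (forall x, derivable f x u) -> (forall x, derivable ('D_u f) x v) ->
  exists s r : R, [/\ 0 < s < h, 0 < r < h &
    f (p + h *: v + h *: u) - f (p + h *: u) - (f (p + h *: v) - f p)
      = 'D_v ('D_u f) (p + s *: u + r *: v) * h * h].
Proof.
move=> h0 du dvu.
pose g (s : R) := f (p + h *: v + s *: u) - f (p + s *: u).
have dg (s : R) : is_derive s 1 g
    ('D_u f (p + h *: v + s *: u) - 'D_u f (p + s *: u)).
  have d1 := is_derive_line (du (p + h *: v + s *: u)).
  have d2 := is_derive_line (du (p + s *: u)).
  exact: is_deriveB.
have [s] := MVT h0 (fun s _ => dg s) (derivable_within_continuous
  (fun s _ => @ex_derive _ _ _ _ _ _ _ (dg s))).
rewrite in_itv/= => s0h gs.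
have dl (r : R) : is_derive r 1 (fun r : R => 'D_u f (p + s *: u + r *: v))
   ('D_v ('D_u f) (p + s *: u + r *: v)) by exact: is_derive_line.
have [r] := MVT h0 (fun r _ => dl r) (derivable_within_continuous
  (fun r _ => @ex_derive _ _ _ _ _ _ _ (dl r))).
rewrite in_itv/= => r0h lr; exists s, r; split=> //.
move: gs; rewrite /g !scale0r !addr0 subr0 => ->; congr (_ * _).
by rewrite -[h in RHS]subr0 -lr scale0r addr0 addrAC.
Qed.

Lemma eq_of_arbitrarily_close_values {V : normedModType R} (A B : V -> R) (p : V) :
  {for p, continuous A} -> {for p, continuous B} ->
  (forall r : R, 0 < r -> exists x y, [/\ ball p r x, ball p r y & A x = B y]) ->
  A p = B p.
Proof.
move=> cA cB AB; apply/eqP; rewrite -subr_eq0 -normr_le0.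
apply/ler_addgt0Pl => e e0; rewrite addr0.
have e2 : 0 < e / 2 by rewrite divr_gt0.
have : \forall x \near p, `|A p - A x| < e / 2 /\ `|B p - B x| < e / 2.
  by apply: filterI; [exact: cvgr_dist_lt cA _ e2|exact: cvgr_dist_lt cB _ e2].
move=> /nbhs_ballP[r /= r0 near_p].
have [x [y [/near_p[Ax _] /near_p[_ By] ABxy]]] := AB r r0.
rewrite -(subrKA (A x)) (le_trans (ler_normD _ _))// (splitr e).
by rewrite lerD// ltW// ABxy distrC.
Qed.

(** The second difference of f does not change when u and v are exchanged, so
    the two mixed derivatives take a common value, at two points as close to p
    as desired. *)
Lemma mixed_derivatives_sym {V : normedModType R} (f : V -> R) (p u v : V) :
  (forall x, derivable f x u) -> (forall x, derivable f x v) ->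
  (forall x, derivable ('D_u f) x v) -> (forall x, derivable ('D_v f) x u) ->
  {for p, continuous ('D_v ('D_u f))} -> {for p, continuous ('D_u ('D_v f))} ->
  'D_v ('D_u f) p = 'D_u ('D_v f) p.
Proof.
move=> du dv dvu duv cvu cuv.
apply: eq_of_arbitrarily_close_values cvu cuv _ => r r0.
pose S := `|u| + `|v| + 1; have S0 : 0 < S by rewrite ltr_wpDl// addr_ge0.
pose h := r / S; have h0 : 0 < h by rewrite divr_gt0.
have in_ball (a b : V) (s t : R) : `|a| + `|b| + 1 = S -> 0 < s < h -> 0 < t < h ->
    ball p r (p + s *: a + t *: b).
  move=> abS /andP[s0 sh] /andP[t0 th]; rewrite -ball_normE/=.
  rewrite -addrA opprD addrA subrr sub0r normrN (le_lt_trans (ler_normD _ _))//.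
  rewrite !normrZ !gtr0_norm// (@le_lt_trans _ _ (h * `|a| + h * `|b|))//.
    by rewrite lerD// ler_wpM2r// ltW.
  by rewrite -mulrDr -(divfK (lt0r_neq0 S0) r) ltr_pM2l// -abS ltrDl.
have [s1 [t1 [s1h t1h E1]]] := second_difference p h0 du dvu.
have [s2 [t2 [s2h t2h E2]]] := second_difference p h0 dv duv.
exists (p + s1 *: u + t1 *: v), (p + s2 *: v + t2 *: u); split.
- exact: in_ball.
- by apply: in_ball => //; rewrite (addrC `|v|).
apply: (mulIf (lt0r_neq0 h0)); apply: (mulIf (lt0r_neq0 h0)).
apply: (etrans (esym E1)); apply: etrans E2; rewrite (addrAC p).
have swap (a b c e : R) : a - b - (c - e) = a - c - (b - e) by ring.
exact: swap.
Qed.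

Lemma hessian_sym {d} (E : 'cV[R]_d -> R) x :
  twice_continuously_differentiable E -> (hessian E x)^T = hessian E x.
Proof.
move=> [dE dgrad chess].
have d1 i y : derivable E y (delta_mx i 0) by exact: diff_derivable.
have d2 i j y : derivable ('D_(delta_mx i 0) E) y (delta_mx j 0).
  have -> : 'D_(delta_mx i 0) E = (fun z => gradient E z i 0).
    by apply/funext => z; rewrite mxE.
  apply: (derivable_mxP (gradient E) y (delta_mx j 0)).1.
  exact: diff_derivable.
have c2 i j y : {for y, continuous ('D_(delta_mx j 0) ('D_(delta_mx i 0) E))}.
  have -> : 'D_(delta_mx j 0) ('D_(delta_mx i 0) E) =
      (fun A : 'M[R]_d => A i j) \o hessian E.
    by apply/funext => z; rewrite /= mxE.
  by apply: continuous_comp; [exact: chess|exact: coord_continuous].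
apply/matrixP => i j; rewrite !mxE.
exact: mixed_derivatives_sym.
Qed.

End MixedDerivatives.

(** * Lipschitz continuity of the vector field *)

Section LipschitzCalculus.
Context {R : realType} {d : nat} {I : finType}.
Local Notation state := (I -> 'cV[R]_d).
Implicit Types s : state.

(** Boundedness is part of the notion because the product rule for Lipschitz
    constants requires it. *)
Definition bounded_lipschitz {W : normedModType R} (f : state -> W) :=
  exists M L : R, [/\ 0 <= M, 0 <= L,
    forall s, in_box 2 s -> `|f s| <= M
    & forall s s', in_box 2 s -> in_box 2 s' ->
      `|f s - f s'| <= L * state_dist s s'].

Lemma blipD {W : normedModType R} (f g : state -> W) :
  bounded_lipschitz f -> bounded_lipschitz g ->
  bounded_lipschitz (fun s => f s + g s).
Proof.
move=> [M [L [M0 L0 fM fL]]] [N [K [N0 K0 gN gK]]].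
exists (M + N), (L + K); split; rewrite ?addr_ge0//.
  by move=> s s2; rewrite le_normD ?fM ?gN.
by move=> s s' s2 s'2; rewrite opprD addrACA mulrDl le_normD ?fL ?gK.
Qed.

Lemma blip_cst {W : normedModType R} (w : W) : bounded_lipschitz (fun=> w).
Proof.
by exists `|w|, 0; split=> // s s' _ _; rewrite subrr normr0 mul0r.
Qed.

Lemma blip_sum {W : normedModType R} (J : Type) (r : seq J) (P : pred J)
    (f : J -> state -> W) :
  (forall j, P j -> bounded_lipschitz (f j)) ->
  bounded_lipschitz (fun s => \sum_(j <- r | P j) f j s).
Proof.
move=> ft; elim: r => [|j r IHr].
  by under eq_fun do rewrite big_nil; exact: blip_cst.
under eq_fun do rewrite big_cons.
by case Pj : (P j) => //; apply: blipD => //; exact: ft.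
Qed.

Lemma blip_bilinear {U V W : normedModType R} (B : U -> V -> W)
    (f : state -> U) (g : state -> V) :
  bounded_bilinear B -> bounded_lipschitz f -> bounded_lipschitz g ->
  bounded_lipschitz (fun s => B (f s) (g s)).
Proof.
move=> bB [M [L [M0 L0 fM fL]]] [N [H [N0 H0 gN gH]]].
have [K K0 BK] := bilinear_boundP bB.
exists (K * (M * N)), (K * (L * N) + K * (M * H)).
split; rewrite ?addr_ge0 ?mulr_ge0//.
  by move=> s s2; apply: BK; [exact: fM|exact: gN].
move=> s s' s2 s'2.
rewrite (_ : _ - _ = B (f s - f s') (g s) + B (f s') (g s - g s')); last first.
  by rewrite (bilinearBl bB) (bilinearBr bB) addrA subrK.
have h1 := BK _ _ _ _ (fL s s' s2 s'2) (gN s s2).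
have h2 := BK _ _ _ _ (fM s' s'2) (gH s s' s2 s'2).
by rewrite (le_trans (le_normD h1 h2))// le_eqVlt; apply/orP; left; apply/eqP; ring.
Qed.

Lemma blipZ {W : normedModType R} (a : state -> R) (f : state -> W) :
  bounded_lipschitz a -> bounded_lipschitz f ->
  bounded_lipschitz (fun s => a s *: f s).
Proof. by move=> ta tf; exact: (blip_bilinear (scale_bounded_bilinear W) ta tf). Qed.

Lemma blipB {W : normedModType R} (f g : state -> W) :
  bounded_lipschitz f -> bounded_lipschitz g ->
  bounded_lipschitz (fun s => f s - g s).
Proof.
move=> tf tg; have := blipD tf (blipZ (blip_cst (-1 : R)) tg).
by under eq_fun do rewrite scaleN1r.
Qed.

Lemma blip_dot (f g : state -> 'cV[R]_d) :
  bounded_lipschitz f -> bounded_lipschitz g ->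
  bounded_lipschitz (fun s => dot (f s) (g s)).
Proof. by move=> tf tg; exact: (blip_bilinear dot_bounded_bilinear tf tg). Qed.

Lemma blip_coord {W : normedModType R} (f : 'cV[R]_d -> W) (L : R) i :
  0 <= L -> (forall x y, `|f x - f y| <= L * `|x - y|) ->
  bounded_lipschitz (fun s => f (s i)).
Proof.
move=> L0 fL; exists (L * 2 + `|f 0|), L; split; rewrite ?addr_ge0 ?mulr_ge0//.
  move=> s s2; rewrite -[f (s i)](subrK (f 0)) le_normD//.
  by rewrite (le_trans (fL _ _))// subr0 ler_wpM2l.
by move=> s s' _ _; rewrite (le_trans (fL _ _))// ler_wpM2l// coord_le_state_dist.
Qed.

Lemma blip_family (G : state -> state) :
  (forall i, bounded_lipschitz (fun s => G s i)) ->
  exists M L : R, [/\ 0 <= M, 0 <= L,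
    forall s i, in_box 2 s -> `|G s i| <= M
    & forall s s' i, in_box 2 s -> in_box 2 s' ->
      `|G s i - G s' i| <= L * state_dist s s'].
Proof.
move=> /choice[M /choice[L GML]].
have M0 i : 0 <= M i by have [] := GML i.
have L0 i : 0 <= L i by have [] := GML i.
exists (\sum_i M i), (\sum_i L i); split; rewrite ?sumr_ge0//.
  move=> s i s2; have [_ _ GM _] := GML i; rewrite (le_trans (GM s s2))//.
  by rewrite (bigD1 i)//= lerDl sumr_ge0.
move=> s s' i s2 s'2; have [_ _ _ GL] := GML i.
rewrite (le_trans (GL s s' s2 s'2))// ler_wpM2r ?state_dist_ge0//.
by rewrite (bigD1 i)//= lerDl sumr_ge0.
Qed.

End LipschitzCalculus.

(** * The dynamics as a one-step method *)

Section ChisdField.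
Context {R : realType} {d k : nat}.
Variables (F : 'cV[R]_d -> 'cV[R]_d) (J : 'cV[R]_d -> 'M[R]_d) (L : R).
Hypothesis L_ge0 : 0 <= L.
Hypothesis F_lipschitz : forall x y, `|F x - F y| <= L * `|x - y|.
Hypothesis J_lipschitz : forall x y, `|J x - J y| <= L * `|x - y|.

(** States are families indexed by [option 'I_k], with [None] standing for the
    position x. *)
Definition pack_state (x : 'cV[R]_d) (v : 'I_k -> 'cV[R]_d) (o : option 'I_k) :=
  if o is Some i then v i else x.

Definition chisd_field (s : option 'I_k -> 'cV[R]_d) : option 'I_k -> 'cV[R]_d :=
  pack_state (chisd_rhs_x F (s None) (s \o Some))
    (chisd_rhs_v F J (s None) (s \o Some)).

Let blip_id o :
  bounded_lipschitz (fun s : option 'I_k -> 'cV[R]_d => s o).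
Proof.
by apply: (blip_coord (f := id) (L := 1)) => // x y; rewrite mul1r.
Qed.

Let blip_F :
  bounded_lipschitz (fun s : option 'I_k -> 'cV[R]_d => F (s None)).
Proof. exact: blip_coord L_ge0 F_lipschitz. Qed.

Let blip_Jv i :
  bounded_lipschitz (fun s : option 'I_k -> 'cV[R]_d => J (s None) *m s (Some i)).
Proof.
have tJ : bounded_lipschitz (fun s : option 'I_k -> 'cV[R]_d => J (s None)).
  exact: blip_coord L_ge0 J_lipschitz.
exact: (blip_bilinear (mulmx_bounded_bilinear _ _ _) tJ (blip_id _)).
Qed.

Lemma chisd_field_blip o : bounded_lipschitz (fun s => chisd_field s o).
Proof.
case: o => [i|] /=.
  under eq_fun do rewrite chisd_rhs_vE /=.
  have tsum : bounded_lipschitz (fun s : option 'I_k -> 'cV[R]_d =>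
    \sum_(j < k | (j < i)%N)
     dot (s (Some j)) (J (s None) *m s (Some i)) *: s (Some j)).
    by apply: blip_sum => j _; apply: blipZ => //; exact: blip_dot.
  apply: blipD; last by apply: blipZ => //; exact: blip_dot.
  apply: blipB; last by apply: blipZ => //; exact: blip_dot.
  apply: blipB; last by apply: blipZ => //; exact: blip_cst.
  by apply: blipB => //; apply: blipZ => //; exact: blip_dot.
under eq_fun do rewrite chisd_rhs_xE /reflected_force /=.
have tsum : bounded_lipschitz (fun s : option 'I_k -> 'cV[R]_d => \sum_j
   dot (s (Some j)) (F (s None)) *: s (Some j)).
  by apply: blip_sum => j _; apply: blipZ => //; exact: blip_dot.
apply: blipB; last by apply: blipZ => //; exact: blip_dot.
by apply: blipB => //; apply: blipZ => //; exact: blip_cst.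
Qed.

Hypothesis J_sym : forall x, (J x)^T = J x.

(** Finitely many jets, so one constant and one bound on the step size; the
    constant depends on F and J only through their bounds on the unit box. *)
Lemma scheme_consistency :
  exists2 C : R, 0 <= C & exists2 tau1 : R, 0 < tau1 &
  forall (tau : R) x v x' v', 0 < tau -> tau <= tau1 ->
    on_manifold x v -> chisd_step F J tau x v x' v' ->
    on_manifold x' v' /\ forall o, `|pack_state x' v' o - pack_state x v o
      - tau *: chisd_field (pack_state x v) o| <= C * tau ^+ 2.
Proof.
have Fb (x : 'cV[R]_d) : `|x| <= 1 -> `|F x| <= L + `|F 0|.
  move=> x1; rewrite -[F x](subrK (F 0)) le_normD// (le_trans (F_lipschitz _ _))//.
  by rewrite subr0 -[leRHS]mulr1 ler_wpM2l.
have Jb (x : 'cV[R]_d) : `|x| <= 1 -> `|J x| <= L + `|J 0|.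
  move=> x1; rewrite -[J x](subrK (J 0)) le_normD// (le_trans (J_lipschitz _ _))//.
  by rewrite subr0 -[leRHS]mulr1 ler_wpM2l.
have [Cx [ex ex0 xC]] := jet_new_x J Fb (k := k).
have /choice[Cv vC] := jet_new_v J_sym Fb Jb (k := k).
have evv := eventually_forall vC.
have evM := manifold_preserved J_sym Fb Jb (k := k).
have [e e0 step_ok] := eventually_and evM (eventually_and
  (ex_intro2 _ _ ex ex0 xC) evv).
exists (`|Cx| + \sum_i `|Cv i|); first by rewrite addr_ge0// sumr_ge0.
exists e => // tau x v x' v' tau0 tau_e Mxv st.
have [Mxv' [[_ _ xn] vn]] :=
  step_ok (StepData tau x v x' v') (And3 tau0 Mxv st) tau_e.
split=> // o; rewrite -addrA -opprD.
have t2 : 0 <= tau ^+ 2 by exact: sqr_ge0.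
have Sv : 0 <= \sum_i `|Cv i| by exact: sumr_ge0.
case: o => [i|] /=; last first.
  rewrite (le_trans xn)// ler_wpM2r//; have := ler_norm Cx; lra.
have [_ _ vni] := vn i; rewrite (le_trans vni)// ler_wpM2r//.
rewrite (le_trans (ler_norm _))// (bigD1 i)//= -[leLHS]add0r lerD//.
by rewrite lerDl sumr_ge0.
Qed.

End ChisdField.

Lemma sum_option {V : nmodType} (I : finType) (f : option I -> V) :
  \sum_o f o = f None + \sum_i f (Some i).
Proof.
rewrite (bigD1 None)//=; congr (_ + _).
rewrite (reindex_omap Some id) => [|[i|]]//=.
by apply: eq_bigl => i; rewrite eqxx.
Qed.

(** * First-order convergence *)

Theorem theorem4p2 (R : realType) (d k : nat) (E : 'cV[R]_d -> R) (L T : R)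
    (x0 : 'cV[R]_d) (v0 : 'I_k -> 'cV[R]_d)
    (hE : twice_continuously_differentiable E)
    (hL : 0 < L) (hA : assumptionA L (force E) (force_jac E))
    (hT : 0 < T) (hk : (1 <= k)%N)
    (hx0 : enorm x0 = 1) (hv0 : orthonormal_family v0)
    (hv0x0 : forall i, dot (v0 i) x0 = 0) :
  exists tau0 Q : R, 0 < tau0 /\ 0 < Q /\
    forall (x : R -> 'cV[R]_d) (v : 'I_k -> R -> 'cV[R]_d),
    chisd_solution (force E) (force_jac E) T x0 v0 x v ->
    forall (N : nat), (0 < N)%N ->
    let tau := T / N%:R in
    tau <= tau0 ->
    forall (xn : nat -> 'cV[R]_d) (vn : 'I_k -> nat -> 'cV[R]_d),
    chisd_scheme (force E) (force_jac E) tau N x0 v0 xn vn ->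
    forall n : nat, (1 <= n <= N)%N ->
      enorm (xn n - x (n%:R * tau))
        + \sum_(i < k) enorm (vn i n - v i (n%:R * tau)) <= Q * tau.
Proof.
set F := force E in hA *; set J := force_jac E in hA *.
(* The dimension d comes from passing from the Euclidean to the max norm. *)
have Ld_ge0 : 0 <= L * d%:R by rewrite mulr_ge0// ltW.
have bound (a b : 'cV[R]_d) : L * enorm (a - b) <= L * d%:R * `|a - b|.
  by rewrite -mulrA (ler_wpM2l (ltW hL) (enorm_le_norm _)).
have F_lip (a b : 'cV[R]_d) : `|F a - F b| <= L * d%:R * `|a - b|.
  apply: le_trans (bound a b); apply: le_trans (hA.1 b a).
  by rewrite (le_trans (norm_le_enorm _))// lerDr opnorm_ge0.
have J_lip (a b : 'cV[R]_d) : `|J a - J b| <= L * d%:R * `|a - b|.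
  apply: le_trans (bound a b); apply: le_trans (hA.1 b a).
  by rewrite (le_trans (norm_le_opnorm _))// lerDl enorm_ge0.
have J_sym a : (J a)^T = J a by rewrite /J /force_jac linearN/= hessian_sym.
have [M [Lip [M_ge0 Lip_ge0 G_M G_lip]]] :=
  blip_family (chisd_field_blip (k := k) Ld_ge0 F_lip J_lip).
have [C C_ge0 [tau1 tau1_gt0 step]] :=
  scheme_consistency (k := k) Ld_ge0 F_lip J_lip J_sym.
have [tau2 [Q [tau2_gt0 [Q_gt0 conv]]]] :=
  one_step_convergence M_ge0 Lip_ge0 G_M G_lip hT C_ge0.
have d1_gt0 : 0 < d%:R + 1 :> R by rewrite ltr_wpDl.
exists (Order.min tau1 tau2), ((d%:R + 1) * Q).
split; first by rewrite lt_min tau1_gt0.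
split; first exact: mulr_gt0.
move=> x v [[x_0 v_0] x_cont v_cont x_der v_der] N N_gt0 tau.
rewrite le_min => /andP[tau_le1 tau_le2] xn vn [xn_0 vn_0 scheme] n /andP[_ nN].
have tau_gt0 : 0 < tau by rewrite divr_gt0// ltr0n.
have manifold m : (m <= N)%N -> on_manifold (xn m) (vn^~ m).
  elim: m => [_|m IHm mN].
    rewrite xn_0 (funext vn_0); split=> //; exact/enorm_eq1.
  exact: (step _ _ _ _ _ tau_gt0 tau_le1 (IHm (ltnW mN)) (scheme m mN)).1.
have y_sol : ode_solution (chisd_field F J) T (fun t => pack_state (x t) (v^~ t)).
  by split=> [[i|]|t [i|]] //= t0T; [exact: v_der|exact: x_der].
have init : pack_state (xn 0%N) (vn^~ 0%N) = pack_state (x 0) (v^~ 0).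
  by rewrite xn_0 x_0 (funext vn_0) (funext v_0).
have box m : (m <= N)%N -> in_box 1 (pack_state (xn m) (vn^~ m)).
  move=> /manifold[xx v_on _] [i|] /=; rewrite (le_trans (norm_le_enorm _))//.
    by rewrite (enorm_eq1 _).2// v_on eqxx.
  by rewrite (enorm_eq1 _).2.
have local m o : (m < N)%N -> `|pack_state (xn m.+1) (vn^~ m.+1) o
    - pack_state (xn m) (vn^~ m) o
    - tau *: chisd_field F J (pack_state (xn m) (vn^~ m)) o| <= C * tau ^+ 2.
  move=> mN.
  exact: (step _ _ _ _ _ tau_gt0 tau_le1 (manifold m (ltnW mN)) (scheme m mN)).2.
have := conv _ y_sol N N_gt0 tau_le2 (fun m => pack_state (xn m) (vn^~ m))
  init box local n nN.
rewrite /state_dist -/tau sum_option/= => dist_le.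
rewrite -mulrA; apply: le_trans (ler_wpM2l (ltW d1_gt0) dist_le).
have norms (u : 'cV[R]_d) : enorm u <= (d%:R + 1) * `|u|.
  by rewrite (le_trans (enorm_le_norm u))// ler_wpM2r// lerDl.
by rewrite mulrDr lerD// mulr_sumr ler_sum.
Qed.
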